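(* For every integer $m>1$ there exists an irreducible $m$-EEC consisting of Beatty sequences all of whose moduli are irrational, which is not of the following form: a family $$\bigcup_{k=1}^{t}\left( \left\{ S(\alpha_{2k-1}a_{i,k},\ \alpha_{2k-1}\phi_{i,k}+\beta_{2k-1}) : 1\le i\le \mu_k\right\} \cup \left\{ S(\alpha_{2k}c_{j,k},\ \alpha_{2k}\psi_{j,k}+\beta_{2k}) : 1\le j\le \nu_k\right\}\right)$$ where $t\ge 1$, $\alpha_1,\dots,\alpha_{2t}$ are positive reals, $\beta_1,\dots,\beta_{2t}$ are reals, the $a_{i,k},c_{j,k}$ are positive integers, the $\phi_{i,k},\psi_{j,k}$ are integers, and there are positive integers $m_1,\dots,m_t,d_1,\dots,d_t$ with $m_1d_1+\cdots+m_td_t = m$ such that for each $k=1,\dots,t$: (i) $\frac{1}{\alpha_{2k-1}}+\frac{1}{\alpha_{2k}} = m_k$; (ii) the residue classes $\{x\in\mathbb{Z}: x\equiv \phi_{i,k} \pmod{a_{i,k}}\}$, $i=1,\dots,\mu_k$, cover every integer exactly $d_k$ times, and likewise the residue classes $\{x\in\mathbb{Z}: x\equiv \psi_{j,k}\pmod{c_{j,k}}\}$, $j=1,\dots,\nu_k$, cover every integer exactly $d_k$ times; (iii) $\frac{\beta_{2k-1}}{\alpha_{2k-1}}+\frac{\beta_{2k}}{\alpha_{2k}}\in\mathbb{Z}$.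
   Context: $\mathbb{N}$ denotes the set of positive integers. For real $\alpha>0$ and real $\beta$, the Beatty sequence $S(\alpha,\beta)$ is the multiset $\{\lfloor n\alpha+\beta\rfloor : n\in\mathbb{N}\}$ (an integer is counted as many times as it occurs); $\alpha$ is its modulus. A finite family $\{S_i : i\in I\}$ of multisets of integers is an $m$-EEC (eventual exact $m$-cover) if every sufficiently large positive integer occurs exactly $m$ times in the multiset union of the family, counting multiplicities. An $m$-EEC with $m>1$ is reducible if there are positive integers $m_1,m_2$ with $m_1+m_2=m$ and a partition $I=J\sqcup K$ such that $\{S_i:i\in J\}$ is an $m_1$-EEC and $\{S_i:i\in K\}$ is an $m_2$-EEC; otherwise it is irreducible. *)

(* Defs.v *)
From HB Require Import structures.
From mathcomp Require Import all_boot all_order all_algebra.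
From mathcomp Require Import finmap.
From mathcomp Require Import mathcomp_extra boolp classical_sets functions.
From mathcomp Require Import cardinality reals.

Set Implicit Arguments.
Unset Strict Implicit.
Unset Printing Implicit Defensive.

Import Order.TTheory GRing.Theory Num.Theory.
Local Open Scope ring_scope.

(* A multiset of integers, given by its multiplicity function. *)
Definition int_multiset := int -> nat.

Definition beatty_indices (R : realType) (alpha beta : R) (x : int) : set nat :=
  [set n : nat | (0 < n)%N /\ Num.floor (n%:R * alpha + beta) = x]%classic.

(* [fset_set] returns the empty set on infinite sets; this never happens for a
   positive modulus. *)
Lemma finite_beatty_indices (R : realType) (alpha beta : R) (x : int) :
  0 < alpha -> finite_set (beatty_indices alpha beta x).
Proof.
move=> alpha_gt0.
pose N := Num.bound `|(x + 1)%:~R / alpha - beta / alpha|.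
apply: (@sub_finite_set _ _ `I_N); last exact: finite_II.
move=> n [_ flx] /=.
have lt1 : n%:R * alpha + beta < (x + 1)%:~R by rewrite -flx; exact: floorD1_gt.
have lt2 : n%:R < (x + 1)%:~R / alpha - beta / alpha.
  by rewrite -mulrBl ltr_pdivlMr // ltrBrDr.
rewrite -(ltr_nat R); apply: (lt_le_trans lt2); apply: le_trans (ler_norm _) _.
exact/ltW/archi_boundP.
Qed.

Definition beatty (R : realType) (alpha beta : R) : int_multiset :=
  fun x => #|` fset_set (beatty_indices alpha beta x)|%fset.

Definition is_EEC (m : nat) (I : finType) (S : I -> int_multiset) : Prop :=
  exists N : nat, forall x : nat, (N <= x)%N -> (\sum_i S i x%:Z)%N = m.

(* The two blocks of the partition of the index type are J and its complement. *)
Definition reducible_EEC (m : nat) (I : finType) (S : I -> int_multiset) : Prop :=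
  exists (m1 m2 : nat) (J : {set I}),
    [/\ (0 < m1)%N, (0 < m2)%N, (m1 + m2)%N = m,
        is_EEC m1 (fun i : {i : I | i \in J} => S (val i))
      & is_EEC m2 (fun i : {i : I | i \notin J} => S (val i))].

Definition irreducible_EEC (m : nat) (I : finType) (S : I -> int_multiset) : Prop :=
  is_EEC m S /\ ~ reducible_EEC m S.

(* The residue classes phi i mod a i cover every integer exactly d times. *)
Definition exact_cover (d n : nat) (phi : 'I_n -> int) (a : 'I_n -> nat) : Prop :=
  forall x : int, #|[pred i : 'I_n | (x == phi i %[mod (a i)%:Z])%Z]| = d.

(* Here and below alpha1 k, beta1 k (resp. alpha2 k, beta2 k) are the
   parameters with odd index 2k-1 (resp. even index 2k), k being counted from
   0 as an element of 'I_t. The index type is a disjoint union, so equal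
   sequences are counted with multiplicity. *)
Definition paired_family (R : realType) (t : nat)
    (alpha1 alpha2 beta1 beta2 : 'I_t -> R) (mu nu : 'I_t -> nat)
    (a : forall k, 'I_(mu k) -> nat) (phi : forall k, 'I_(mu k) -> int)
    (c : forall k, 'I_(nu k) -> nat) (psi : forall k, 'I_(nu k) -> int)
    (p : {k : 'I_t & ('I_(mu k) + 'I_(nu k))%type}) : int_multiset :=
  let: existT k s := p in
  match s with
  | inl i => beatty (alpha1 k * (a k i)%:R) (alpha1 k * (phi k i)%:~R + beta1 k)
  | inr j => beatty (alpha2 k * (c k j)%:R) (alpha2 k * (psi k j)%:~R + beta2 k)
  end.

Definition of_paired_form (R : realType) (m : nat)
    (I : finType) (S : I -> int_multiset) : Prop :=
  exists (t : nat) (alpha1 alpha2 beta1 beta2 : 'I_t -> R)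
         (mu nu : 'I_t -> nat)
         (a : forall k, 'I_(mu k) -> nat) (phi : forall k, 'I_(mu k) -> int)
         (c : forall k, 'I_(nu k) -> nat) (psi : forall k, 'I_(nu k) -> int)
         (ms ds : 'I_t -> nat),
    (0 < t)%N /\
    (forall k, 0 < alpha1 k /\ 0 < alpha2 k) /\
    (forall k i, (0 < a k i)%N) /\
    (forall k j, (0 < c k j)%N) /\
    (forall k, (0 < ms k)%N /\ (0 < ds k)%N) /\
    (\sum_k ms k * ds k)%N = m /\
    (forall k, (alpha1 k)^-1 + (alpha2 k)^-1 = (ms k)%:R) /\
    (forall k, exact_cover (ds k) (phi k) (a k) /\
               exact_cover (ds k) (psi k) (c k)) /\
    (forall k, beta1 k / alpha1 k + beta2 k / alpha2 k \is a Num.int) /\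
    exists f : I -> {k : 'I_t & ('I_(mu k) + 'I_(nu k))%type},
      bijective f /\
      forall i, S i =1 paired_family alpha1 alpha2 beta1 beta2 a phi c psi (f i).

(* Main.v *)
Require Import Defs.
From mathcomp Require Import all_boot all_order all_algebra finmap.
From mathcomp Require Import boolp classical_sets cardinality reals.
From mathcomp Require Import zify ring lra.
Import Order.TTheory GRing.Theory Num.Theory.
Local Open Scope ring_scope.

(** Fix an irrational [theta] in (0, 1) and take three Beatty sequences with
    densities (inverse moduli) theta/2, m-1+theta/2 and 1-theta, the second
    one with offset half its modulus. Large [x] occurs in S(alpha, beta)
    exactly ceil((x+1-beta)/alpha) - ceil((x-beta)/alpha) times, and with
    u = x theta/2 the three ceilings add up to
    m x + ceil(u) + ceil(u-1/2) + ceil(-2u) = m x + 1, so this is an m-EEC.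
    The densities of an m-EEC add up to m, and no proper nonempty subfamily of
    the three densities has an integer sum; hence irreducibility. In a family
    of the paired form the densities of the k-th block add up to m_k d_k, so a
    single block would contain all three sequences. Two of them would then lie
    in the same half of that block and have a rational ratio of densities, but
    the three densities are pairwise incommensurable. *)

(** * Densities with bounded error *)

(** A bounded error replaces a limit: it is stronger, it holds for all the counting functions below,
    and it adds up over finite families without any limit argument. *)
Definition has_density {R : realType} (S : nat -> nat) (d : R) :=
  exists C : R, forall N, `|(\sum_(x < N) S x)%:R - N%:R * d| <= C.

(** Subtracting the two estimates gives [N * |d - e| <= C + D] for every [N], which the Archimedean
    property forbids unless [d = e]. *)
Lemma has_density_uniq {R : realType} (S : nat -> nat) (d e : R) :
  has_density S d -> has_density S e -> d = e.
Proof.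
move=> [C hC] [D hD]; apply/eqP; rewrite -subr_eq0; apply/negPn/negP => dne.
have lo : 0 < `|d - e| by rewrite normr_gt0.
have [N CDN] : exists N : nat, (C + D) / `|d - e| < N%:R.
  exists (Num.bound `|(C + D) / `|d - e| |).
  exact: le_lt_trans (ler_norm _) (archi_boundP (normr_ge0 _)).
move: CDN; rewrite ltr_pdivrMr // ltNge => /negP; apply.
rewrite -[N%:R]ger0_norm // -normrM.
have -> : N%:R * (d - e) = ((\sum_(x < N) S x)%:R - N%:R * e)
   - ((\sum_(x < N) S x)%:R - N%:R * d) by ring.
by apply: le_trans (ler_normB _ _) _; rewrite addrC lerD.
Qed.

Lemma has_density_ext {R : realType} (S T : nat -> nat) (d : R) :
  S =1 T -> has_density S d -> has_density T d.
Proof. by move=> /funext ->. Qed.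

Lemma has_density_sum {R : realType} (I : finType) (P : pred I)
    (S : I -> nat -> nat) (d : I -> R) :
  (forall i, P i -> has_density (S i) (d i)) ->
  has_density (fun x => \sum_(i | P i) S i x)%N (\sum_(i | P i) d i).
Proof.
move=> dens.
have /choice[C hC] i : exists C : R, P i ->
    forall N, `|(\sum_(x < N) S i x)%:R - N%:R * d i| <= C.
  by have [/dens[C]|] := boolP (P i); [exists C | exists 0].
exists (\sum_(i | P i) C i) => N.
rewrite exchange_big natr_sum mulr_sumr -sumrB.
by apply: le_trans (ler_norm_sum _ _ _) _; apply: ler_sum => i /hC.
Qed.

Lemma has_density_telescope {R : realType} (S : nat -> nat) (d C : R)
    (g : nat -> R) (N0 : nat) :
  (forall x, (N0 <= x)%N -> (S x)%:R = g x.+1 - g x) ->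
  (forall x, `|g x - x%:R * d| <= C) ->
  has_density S d.
Proof.
move=> Sg gC.
have sumS N : (\sum_(x < N0 + N) S x)%:R
    = (\sum_(x < N0) S x)%:R + (g (N0 + N)%N - g N0).
  elim: N => [|N IH]; first by rewrite addn0 subrr addr0.
  by rewrite addnS big_ord_recr natrD IH /= Sg ?leq_addr // addrA; ring.
(* The first sum covers the finitely many [N < N0], before telescoping starts; the remaining terms
   cover [N0 <= N]. *)
exists (\sum_(N < N0) `|(\sum_(x < N) S x)%:R - N%:R * d|
   + (C + `|(\sum_(x < N0) S x)%:R - g N0|)) => N.
have C0 : 0 <= C by apply: le_trans (gC 0%N).
have [N0N|NN0] := leqP N0 N; last first.
  rewrite (bigD1 (Ordinal NN0)) //= -!addrA lerDl !addr_ge0 //.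
  exact: sumr_ge0.
apply: (@le_trans _ _ (C + `|(\sum_(x < N0) S x)%:R - g N0|)); last first.
  by rewrite lerDr sumr_ge0.
rewrite -(subnKC N0N) sumS.
set M := (N0 + _)%N.
have -> : (\sum_(x < N0) S x)%:R + (g M - g N0) - M%:R * d =
  (g M - M%:R * d) + ((\sum_(x < N0) S x)%:R - g N0) by ring.
by apply: le_trans (ler_normD _ _) _; rewrite lerD2r.
Qed.

Lemma has_density_const {R : realType} (S : nat -> nat) (m N0 : nat) :
  (forall x, (N0 <= x)%N -> S x = m) -> has_density S (m%:R : R).
Proof.
move=> Sm.
apply: (@has_density_telescope _ _ _ 0 (fun x => x%:R * m%:R) N0) => x.
  by move/Sm ->; rewrite -natr1; ring.
by rewrite subrr normr0.
Qed.

(** * Densities of Beatty sequences and of residue classes *)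

(** The floor of [n * alpha + beta] is [x] exactly when [n] lies in the half-open interval from
    [(x - beta) / alpha] to [(x + 1 - beta) / alpha]. Since [beta < x], its left end is positive, so
    [0 < n] is automatic. *)
Lemma beatty_ceil {R : realType} (alpha beta : R) (x : int) :
  0 < alpha -> beta < x%:~R ->
  (beatty alpha beta x)%:Z =
  Num.ceil ((x + 1)%:~R / alpha - beta / alpha)
  - Num.ceil (x%:~R / alpha - beta / alpha).
Proof.
move=> a0 bx.
set A := Num.ceil (x%:~R / _ - _); set B := Num.ceil _.
have A_gt0 : 0 < A by rewrite ceil_gt0 -mulrBl divr_gt0 // subr_gt0.
have leAB : A <= B.
  by apply: le_ceil; rewrite lerD2r ler_pM2r ?invr_gt0 // ler_int lerDl.
rewrite /beatty.
have -> : beatty_indices alpha beta x =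
    [set` [fset n in iota `|A|%N (`|B| - `|A|)%N]%fset]%classic.
  apply/seteqP; split => n /=; rewrite !inE /= mem_iota.
    move=> [n0 fl].
    have := floor_itv (n%:R * alpha + beta); rewrite fl => /andP[h1 h2].
    have : A <= n%:Z by rewrite ceil_le_int -mulrBl ler_pdivrMr // lerBlDr.
    have : n%:Z < B by rewrite ceil_gt_int -mulrBl ltr_pdivlMr // ltrBrDr.
    lia.
  move=> /andP[h1 h2]; split; first lia.
  have : A <= n%:Z by lia.
  have : n%:Z < B by lia.
  rewrite ceil_gt_int -mulrBl ltr_pdivlMr // ltrBrDr => h3.
  rewrite ceil_le_int -mulrBl ler_pdivrMr // lerBlDr => h4.
  by apply/floor_def/andP.
by rewrite set_fsetK card_fseq undup_id ?iota_uniq // size_iota; lia.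
Qed.

Lemma has_density_beatty {R : realType} (alpha beta : R) :
  0 < alpha -> has_density (fun x => beatty alpha beta x%:Z) alpha^-1.
Proof.
move=> a0; set b := beta / alpha.
apply: (@has_density_telescope _ _ _ (1 + `|b|)
  (fun x => (Num.ceil (x%:R / alpha - b))%:~R) (Num.bound `|beta|)) => x.
  move=> bx.
  have bltx : beta < x%:R.
    apply: le_lt_trans (ler_norm _) (lt_le_trans (archi_boundP (normr_ge0 _)) _).
    by rewrite ler_nat.
  rewrite -[LHS]/((beatty alpha beta x)%:Z%:~R) beatty_ceil // rmorphB /=.
  by rewrite intrD natr1.
have := ceil_ge (x%:R / alpha - b).
have := ceilB1_lt (x%:R / alpha - b).
rewrite rmorphB /= => h1 h2.
rewrite ler_norml; have := ler_norm b; have := ler_norm (- b); rewrite normrN.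
by move=> *; apply/andP; split; lra.
Qed.

Lemma divz_pred (z : int) (a : nat) : (0 < a)%N ->
  (z %/ a)%Z = ((z - 1) %/ a)%Z + (a %| z)%Z :> int.
Proof.
move=> a_gt0; have a0 : a%:Z != 0 by lia.
have [/dvdzP[q ->]|nd] := boolP (a %| z)%Z.
  rewrite mulzK // divzMDl // -[RHS]addrA -[LHS]addr0; congr (_ + _).
  have -> : (-1 %/ a)%Z = -1; last by [].
  by rewrite -[-1]/(Negz 0) divNz_nat // div0n.
have -> : z - 1 = (z %/ a)%Z * a + ((z %% a)%Z - 1) by rewrite addrA -divz_eq.
rewrite divzMDl // (@divz_small (_ - 1)) ?addr0 //.
have := modz_ge0 z a0; have := ltz_mod z a0.
have : (z %% a)%Z != 0 by apply: contra nd => /eqP/dvdz_mod0P.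
lia.
Qed.

(** The floor of [(x - phi - 1) / a] increases by 1 from [x] to [x + 1] when [a] divides [x - phi],
    and is otherwise unchanged, so it telescopes the indicator of the class. *)
Lemma has_density_residue {R : realType} (phi : int) (a : nat) :
  (0 < a)%N ->
  has_density (fun x => (x%:Z == phi %[mod a%:Z])%Z : nat) (a%:R^-1 : R).
Proof.
move=> a_gt0; have a0 : a%:Z != 0 by lia.
have aR : 0 < a%:R :> R by rewrite ltr0n.
apply: (@has_density_telescope _ _ _ (`|phi%:~R + 1| / a%:R + 1)
  (fun x => ((x%:Z - phi - 1) %/ a%:Z)%Z%:~R) 0%N) => x.
  move=> _; rewrite eqz_mod_dvd -rmorphB /=.
  have -> : x.+1%:Z - phi - 1 = x%:Z - phi by lia.
  by rewrite (divz_pred _ _ a_gt0) addrAC subrr add0r.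
set q := divz _ _; set r := ((x%:Z - phi - 1) %% a%:Z)%Z.
have eq_x : x%:R = q%:~R * a%:R + r%:~R + phi%:~R + 1 :> R.
  have : x%:Z = q * a%:Z + r + phi + 1 by rewrite -divz_eq; ring.
  by move=> /(congr1 (fun z => z%:~R : R)); rewrite !rmorphD rmorphM.
have -> : q%:~R - x%:R / a%:R = - (r%:~R / a%:R) - (phi%:~R + 1) / a%:R :> R.
  by rewrite eq_x; field; rewrite gt_eqF.
apply: le_trans (ler_normB _ _) _.
rewrite normrN normrM [X in _ + X]normrM normfV (gtr0_norm aR) addrC lerD2l.
rewrite ler_pdivrMr // mul1r ger0_norm ?ler0z ?modz_ge0 //.
by rewrite -[a%:R]/(a%:Z%:~R) ler_int ltW // ltz_mod.
Qed.

(** The number of classes containing [x] has density the sum of the inverse moduli, but it is also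
    constantly [d]. *)
Lemma exact_cover_sum_inv {R : realType} (d n : nat) (phi : 'I_n -> int)
    (a : 'I_n -> nat) :
  (forall i, 0 < a i)%N -> exact_cover d phi a ->
  \sum_i (a i)%:R^-1 = d%:R :> R.
Proof.
move=> a_gt0 cov.
have /has_density_uniq : has_density
    (fun x => \sum_i ((x%:Z == phi i %[mod (a i)%:Z])%Z : nat))%N
    (\sum_i (a i)%:R^-1 : R).
  by apply: has_density_sum => i _; exact: has_density_residue.
apply; apply: (@has_density_const _ _ _ 0%N) => x _.
rewrite -[RHS](cov x%:Z) -sum1_card [RHS]big_mkcond.
by apply: eq_bigr => i _; rewrite inE; case: ifP.
Qed.

Lemma EEC_sum_inv {R : realType} (m : nat) (I : finType) (alpha beta : I -> R) :
  (forall i, 0 < alpha i) -> is_EEC m (fun i => beatty (alpha i) (beta i)) ->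
  \sum_i (alpha i)^-1 = m%:R.
Proof.
move=> alpha_gt0 [N cov].
have /has_density_uniq : has_density
    (fun x => \sum_i beatty (alpha i) (beta i) x%:Z)%N (\sum_i (alpha i)^-1).
  by apply: has_density_sum => i _; exact: has_density_beatty.
by apply; exact: has_density_const cov.
Qed.

Lemma beatty_inj {R : realType} (alpha alpha' beta beta' : R) :
  0 < alpha -> 0 < alpha' -> beatty alpha beta =1 beatty alpha' beta' ->
  alpha^-1 = alpha'^-1.
Proof.
move=> a0 a0' eq_b.
apply: (@has_density_uniq _ (fun x => beatty alpha beta x%:Z)).
  exact: has_density_beatty.
apply: (has_density_ext _ _ _ _ (has_density_beatty alpha' beta' a0')) => x.
by rewrite eq_b.
Qed.

(** * A ceiling identity and irrationality *)

(** By Hermite's identity the first two ceilings add up to that of [2 * u]; the ceilings of a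
    non-integer and of its opposite add up to 1. The proof distinguishes the two halves of the unit
    interval ending at [k]. *)
Lemma ceil_add_half {R : realType} (u : R) : 2 * u \isn't a Num.int ->
  Num.ceil u + Num.ceil (u - 2^-1) + Num.ceil (- (2 * u)) = 1.
Proof.
move=> u2; set k := Num.ceil u.
have /andP[] := ceil_itv u; rewrite -/k rmorphB /= => h1 h2.
have [h|h] := lerP u (k%:~R - 2^-1).
  have -> : Num.ceil (u - 2^-1) = k - 1.
    by apply: ceil_def; rewrite !rmorphB /=; apply/andP; split; lra.
  have -> : Num.ceil (- (2 * u)) = 2 - 2 * k; last by lia.
  apply: ceil_def; rewrite !rmorphB rmorphM /=; apply/andP; split; last lra.
  (* Strictness fails only if [2 * u] is the integer [2 * k - 1]. *)
  rewrite lt_neqAle; apply/andP; split; last lra.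
  apply: contra u2 => /eqP e.
  have -> : 2 * u = (2 * k - 1)%:~R by rewrite rmorphB rmorphM /=; lra.
  exact: intr_int.
have -> : Num.ceil (u - 2^-1) = k.
  by apply: ceil_def; rewrite !rmorphB /=; apply/andP; split; lra.
have -> : Num.ceil (- (2 * u)) = 1 - 2 * k; last by lia.
apply: ceil_def; rewrite !rmorphB rmorphM /=; apply/andP; split; last lra.
rewrite lt_neqAle; apply/andP; split; last lra.
apply: contra u2 => /eqP e.
have -> : 2 * u = (2 * k)%:~R by rewrite rmorphM /=; lra.
exact: intr_int.
Qed.

(** The exponent of 2 is even in the squared numerator and odd in twice the squared denominator. *)
Lemma sqr_rat_neq2 (q : rat) : q ^+ 2 != 2.
Proof.
apply/negP => /eqP q2.
have d0 := denq_neq0 q.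
have : numq q ^+ 2 = 2 * denq q ^+ 2.
  apply: (@intr_inj rat).
  by rewrite rmorphXn [RHS]rmorphM rmorphXn /= -[2%:~R]q2 numqE exprMn //.
move=> /(congr1 absz); rewrite abszM !abszX => e.
have n0 : (0 < `|numq q|)%N.
  rewrite lt0n absz_eq0; apply/eqP => n0; move: e; rewrite n0.
  by rewrite exp0n // => /eqP; rewrite eq_sym muln_eq0 expn_eq0 !absz_eq0 (negPf d0).
have dp : (0 < `|denq q|)%N by rewrite absz_gt0.
move: e => /(congr1 (fun n => odd (logn 2 n))).
by rewrite lognM ?expn_gt0 ?dp // !lognX oddD !oddM.
Qed.

Lemma exists_irrational01 (R : realType) :
  exists theta : R, [/\ 0 < theta, theta < 1 & irrational theta].
Proof.
have s2 : Num.sqrt 2 ^+ 2 = 2 :> R by rewrite sqr_sqrtr.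
have s0 : 0 <= Num.sqrt 2 :> R by exact: sqrtr_ge0.
exists (Num.sqrt 2 - 1); split; [nra | nra | move=> [q _ eq_q]].
have := sqr_rat_neq2 (q + 1); apply/negP; rewrite negbK.
apply/eqP/(fmorph_inj (@ratr R)); rewrite rmorphXn rmorphD /= eq_q rmorph1 subrK.
by rewrite s2 rmorph_nat.
Qed.

(** Linear independence of 1 and [theta] over the rationals, which lets relations between densities
    be compared coefficient by coefficient. *)
Lemma irrational_affine_eq0 {R : realType} (theta : R) (a b : rat) :
  irrational theta -> ratr a + ratr b * theta = 0 -> a = 0 /\ b = 0.
Proof.
move=> irr e; have [b0|b0] := eqVneq b 0.
  split=> //; apply: (fmorph_inj (@ratr R)).
  by rewrite rmorph0 -e b0 rmorph0 mul0r addr0.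
case: irr; exists (- a / b) => //; rewrite fmorph_div rmorphN /=.
have rb0 : ratr b != 0 :> R by rewrite fmorph_eq0.
apply: (mulfI rb0); rewrite mulrCA divff // mulr1.
by move/eqP: e; rewrite addrC addr_eq0 => /eqP ->.
Qed.

(** * The three sequences of the counterexample *)

(* The i-th density is [const_coef m i + theta_coef i * theta], its modulus is
   [(tau theta m i)^-1]. *)
Definition const_coef (m : nat) (i : 'I_3) : rat := nth 0 [:: 0; m%:R - 1; 1] i.

Definition theta_coef (i : 'I_3) : rat := nth 0 [:: 2^-1; 2^-1; -1] i.

Definition tau {R : realType} (theta : R) (m : nat) (i : 'I_3) : R :=
  ratr (const_coef m i) + ratr (theta_coef i) * theta.

(* Since beta / alpha = beta * tau, this shifts only the middle ceiling, by 1/2. *)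
Definition shift {R : realType} (theta : R) (m : nat) (i : 'I_3) : R :=
  if i == 1 :> nat then (2 * tau theta m i)^-1 else 0.

Lemma forall_I3 (P : 'I_3 -> Prop) :
  P ord0 -> P (lift ord0 ord0) -> P ord_max -> forall i, P i.
Proof.
move=> P0 P1 P2 [[|[|[|//]]] lti].
- by rewrite (_ : Ordinal _ = ord0) //; apply: val_inj.
- by rewrite (_ : Ordinal _ = lift ord0 ord0) //; apply: val_inj.
- by rewrite (_ : Ordinal _ = ord_max) //; apply: val_inj.
Qed.

Lemma tau0 {R : realType} (theta : R) (m : nat) : tau theta m ord0 = theta / 2.
Proof. by rewrite /tau /= rmorph0 add0r fmorphV rmorph_nat mulrC. Qed.

Lemma tau1 {R : realType} (theta : R) (m : nat) :
  tau theta m (lift ord0 ord0) = m%:R - 1 + theta / 2.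
Proof. by rewrite /tau /= rmorphB rmorph1 !rmorph_nat fmorphV rmorph_nat mulrC. Qed.

Lemma tau2 {R : realType} (theta : R) (m : nat) : tau theta m ord_max = 1 - theta.
Proof. by rewrite /tau /= rmorphN !rmorph1 mulN1r. Qed.

Lemma tau_gt0 {R : realType} (theta : R) (m : nat) (i : 'I_3) :
  0 < theta -> theta < 1 -> (1 < m)%N -> 0 < tau theta m i.
Proof.
move=> theta_gt0 theta_lt1 m_gt1; have : 1 < m%:R :> R by rewrite ltr1n.
by elim/forall_I3: i; rewrite ?tau0 ?tau1 ?tau2; lra.
Qed.

Lemma theta_coef_neq0 i : theta_coef i != 0.
Proof. by elim/forall_I3: i. Qed.

Lemma tau_inv_irrational {R : realType} (theta : R) (m : nat) (i : 'I_3) :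
  irrational theta -> irrational (tau theta m i)^-1.
Proof.
move=> irr [q _ eq_q].
have [|_ /eqP] := @irrational_affine_eq0 _ _ (const_coef m i - q^-1) (theta_coef i) irr.
  by rewrite rmorphB fmorphV /= eq_q invrK /tau; ring.
by rewrite (negPf (theta_coef_neq0 i)).
Qed.

(** The coefficients 1/2, 1/2, -1 of [theta] must cancel over [P], which happens only for the empty
    and the full subfamily. *)
Lemma tau_subsum {R : realType} (theta : R) (m n : nat) (P : pred 'I_3) :
  irrational theta -> \sum_(i | P i) tau theta m i = n%:R -> forall i j, P i = P j.
Proof.
move=> irr; rewrite /tau big_split /= -mulr_suml -!rmorph_sum /= => e.
have [|_ /eqP] := @irrational_affine_eq0 _ _ (\sum_(i | P i) const_coef m i - n%:R)
   (\sum_(i | P i) theta_coef i) irr.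
  by rewrite rmorphB rmorph_nat /= -e; ring.
rewrite big_mkcond !big_ord_recl big_ord0 /=.
rewrite (_ : lift ord0 (lift ord0 ord0) = ord_max); last exact: val_inj.
move=> h i j; suff eqP0 i' : P i' = P ord0 by rewrite !eqP0.
move: h; elim/forall_I3: i'; do 3 case: (P _) => //=.
Qed.

(** Signs of the [theta] coefficients separate the third density from the others. For the first two,
    equal [theta] coefficients force [a = b], and the constants 0 and [m - 1] then differ. *)
Lemma tau_commensurable {R : realType} (theta : R) (m : nat) (i j : 'I_3)
    (a b : nat) :
  irrational theta -> (1 < m)%N -> (0 < a)%N -> (0 < b)%N ->
  a%:R * tau theta m i = b%:R * tau theta m j -> i = j.
Proof.
move=> irr m_gt1 a0 b0 e.
have [|] := @irrational_affine_eq0 _ _ (a%:R * const_coef m i - b%:R * const_coef m j)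
   (a%:R * theta_coef i - b%:R * theta_coef j) irr.
  rewrite !rmorphB !rmorphM /= !rmorph_nat; move: e; rewrite /tau => /eqP.
  by rewrite -subr_eq0 => /eqP <-; ring.
have {a0} : 0 < a%:R :> rat by rewrite ltr0n.
have {b0} : 0 < b%:R :> rat by rewrite ltr0n.
have : 1 < m%:R :> rat by rewrite ltr1n.
move: (a%:R : rat) (b%:R : rat) => a' b' {e}.
rewrite /const_coef /theta_coef; elim/forall_I3: i; elim/forall_I3: j => //=.
all: by move=> m1 b0 a0 e1 e2; exfalso; nra.
Qed.

Lemma tau_ceil_sum {R : realType} (theta : R) (m x : nat) :
  0 < theta -> theta < 1 -> irrational theta -> (1 < m)%N -> (0 < x)%N ->
  \sum_i Num.ceil (x%:~R / (tau theta m i)^-1 - shift theta m i / (tau theta m i)^-1)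
  = (m * x)%:Z + 1.
Proof.
move=> theta_gt0 theta_lt1 irr m_gt1 x_gt0.
rewrite !big_ord_recl big_ord0 /shift /= !mul0r !subr0 !invrK.
rewrite (_ : lift ord0 (lift ord0 ord0) = ord_max); last exact: val_inj.
set t1 := tau _ _ (lift _ _).
have t1_neq0 : t1 != 0 by rewrite gt_eqF // tau_gt0.
have -> : (2 * t1)^-1 * t1 = 2^-1 by field.
rewrite /t1 tau0 tau1 tau2.
set u := x%:~R * (theta / 2).
have -> : x%:~R * (m%:R - 1 + theta / 2) - 2^-1 = u - 2^-1 + (x%:Z * (m%:Z - 1))%:~R.
  by rewrite /u rmorphM rmorphB /=; ring.
have -> : x%:~R * (1 - theta) = - (2 * u) + x%:~R by rewrite /u; field.
rewrite (ceilDrz (u - _)) ?intr_int // (ceilDrz (- _)) ?intr_int // !intrKceil.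
(* Here [2 * u = x * theta] with [x] positive, so an integer value would make [theta] rational. *)
have /ceil_add_half : 2 * u \isn't a Num.int.
  apply/negP => /intrP[k ku]; apply: irr; exists (k%:~R / x%:R) => //.
  rewrite fmorph_div rmorph_int rmorph_nat -ku /u -pmulrn; field.
  by rewrite pnatr_eq0 -lt0n.
by rewrite PoszM => e; lra.
Qed.

Lemma tau_EEC {R : realType} (theta : R) (m : nat) :
  0 < theta -> theta < 1 -> irrational theta -> (1 < m)%N ->
  is_EEC m (fun i => beatty (tau theta m i)^-1 (shift theta m i)).
Proof.
move=> theta_gt0 theta_lt1 irr m_gt1.
set s := \sum_i `|shift theta m i|.
(* Beyond this threshold every offset is below [x], as [beatty_ceil] requires, and [x] is positive,
   as [tau_ceil_sum] requires. *)
exists (Num.bound s).+1 => x x_large.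
have s_lt_x : s < x%:R.
  apply: lt_trans (archi_boundP _) _; first exact: sumr_ge0.
  by rewrite ltr_nat.
apply/eqP; rewrite -eqz_nat (big_morph Posz PoszD (erefl _)); apply/eqP.
under eq_bigr => i _.
  rewrite beatty_ceil ?invr_gt0 ?tau_gt0 //; last first.
    apply: le_lt_trans s_lt_x; apply: le_trans (ler_norm _) _.
    by rewrite /s (bigD1 i) //= lerDl sumr_ge0.
  over.
rewrite sumrB (_ : x%:Z + 1 = x.+1%:Z); last lia.
rewrite !tau_ceil_sum //; lia.
Qed.

Theorem theorem4p9 (R : realType) (m : nat) (hm : (1 < m)%N) :
  exists (I : finType) (alpha beta : I -> R),
    (forall i, 0 < alpha i /\ irrational (alpha i)) /\
    irreducible_EEC m (fun i => beatty (alpha i) (beta i)) /\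
    ~ of_paired_form R m (fun i => beatty (alpha i) (beta i)).
Proof.
have [theta [theta_gt0 theta_lt1 irr]] := exists_irrational01 R.
pose t := tau theta m.
have t_gt0 i : 0 < (t i)^-1 by rewrite invr_gt0 tau_gt0.
exists 'I_3, (fun i => (t i)^-1), (shift theta m); split; last split.
- by move=> i; split=> //; exact: tau_inv_irrational.
- split; first exact: tau_EEC.
  move=> [m1 [m2 [J [m1_gt0 m2_gt0 _ covJ covK]]]].
  have sumJ := EEC_sum_inv _ _ (fun j => (t (val j))^-1) _ (fun=> t_gt0 _) covJ.
  have sumK := EEC_sum_inv _ _ (fun j => (t (val j))^-1) _ (fun=> t_gt0 _) covK.
  have inJ i j : (i \in J) = (j \in J).
    apply: (tau_subsum theta m m1 (fun i => i \in J) irr).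
    rewrite -sumJ [RHS](eq_bigr (fun j => t (val j))); last first.
      by move=> ? _; rewrite invrK.
    by rewrite big_sub.
  (* One of the two blocks is empty, so its density sum is 0, against [m1] and [m2] being
     positive. *)
  have [J0|J0] := boolP (ord0 \in J).
    move: sumK; rewrite big_pred0; last by move=> [i]; rewrite (inJ i ord0) J0.
    by move=> /eqP; rewrite eq_sym pnatr_eq0 -[_ == _]negbK -lt0n m2_gt0.
  move: sumJ; rewrite big_pred0; last by move=> [i]; rewrite (inJ i ord0) (negPf J0).
  by move=> /eqP; rewrite eq_sym pnatr_eq0 -[_ == _]negbK -lt0n m1_gt0.
move=> [T [alpha1 [alpha2 [beta1 [beta2 [mu [nu [a [phi [c [psi [ms [ds]]]]]]]]]]]]].
move=> [_ [alpha_gt0 [a_gt0 [c_gt0 [_ [_ [sum_inv [cov [_ [f [f_bij eq_S]]]]]]]]]]].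
pose dens (p : {k : 'I_T & ('I_(mu k) + 'I_(nu k))%type}) : R :=
  let: existT k s := p in
  match s with
  | inl i => (alpha1 k * (a k i)%:R)^-1
  | inr j => (alpha2 k * (c k j)%:R)^-1
  end.
have t_dens i : t i = dens (f i).
  rewrite -[t i]invrK; have := eq_S i; rewrite /dens; case: (f i) => k [] j /=.
    by apply: beatty_inj => //; rewrite mulr_gt0 ?ltr0n //; case: (alpha_gt0 k).
  by apply: beatty_inj => //; rewrite mulr_gt0 ?ltr0n //; case: (alpha_gt0 k).
(* Each half of block [k] contributes its inverse [alpha] times [ds k], by the exact covers. *)
have block_sum k : \sum_(i | tag (f i) == k) t i = (ms k * ds k)%:R.
  rewrite (eq_bigr (fun i => dens (f i))) //.
  rewrite -(reindex f (P := fun p => tag p == k)) /=; last exact: onW_bij.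
  have -> : \sum_(p | tag p == k) dens p =
      \sum_(s : ('I_(mu k) + 'I_(nu k))%type) dens (existT _ k s).
    rewrite -(big_pred1_eq +%R k (fun k : 'I_T =>
      \sum_(s : ('I_(mu k) + 'I_(nu k))%type) dens (existT _ k s))) sig_big_dep.
    by apply: eq_big => [p|[]] //; rewrite andbT.
  rewrite big_sumType /=.
  have [cova covc] := cov k.
  under eq_bigr do rewrite invfM.
  under [X in _ + X]eq_bigr do rewrite invfM.
  rewrite -!mulr_sumr (exact_cover_sum_inv _ _ _ _ (a_gt0 k) cova).
  by rewrite (exact_cover_sum_inv _ _ _ _ (c_gt0 k) covc) -mulrDl sum_inv natrM.
(* The block of [j] has an integer density sum and contains [j], so it contains all three
   sequences. *)
have same_tag i j : tag (f i) = tag (f j).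
  have := tau_subsum _ _ _ _ irr (block_sum (tag (f j))) i j.
  by rewrite eqxx => /eqP.
pose side i := if tagged (f i) is inl _ then true else false.
(* Within one half all moduli are integer multiples of the same [alpha], which makes the densities
   commensurable. *)
have side_inj : injective side.
  move=> i j side_ij; have [ci [cj [ci0 cj0 comm]]] : exists ci cj : nat,
      [/\ (0 < ci)%N, (0 < cj)%N & ci%:R * t i = cj%:R * t j].
    rewrite !t_dens; move: (same_tag i j) side_ij; rewrite /side.
    case: (f i) (f j) => k s [k' s'] /= kk'; subst k'.
    have [a1 a2] := alpha_gt0 k.
    case: s s' => [u|u] [v|v] //= _; [exists (a k u), (a k v)|exists (c k u), (c k v)].
      split=> //; field; have := a_gt0 k u; have := a_gt0 k v.
      by rewrite !lt0n !pnatr_eq0 (gt_eqF a1) => -> ->.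
    split=> //; field; have := c_gt0 k u; have := c_gt0 k v.
    by rewrite !lt0n !pnatr_eq0 (gt_eqF a2) => -> ->.
  exact: tau_commensurable irr hm ci0 cj0 comm.
by have := leq_card _ side_inj; rewrite card_ord card_bool.
Qed.
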